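(* Let $\mathcal{A}$ be an abelian category and $\mathcal{X}$ an additive subcategory of $\mathcal{A}$. Then the following three subcategories coincide: (a) the admissible-subobject closure of $\mathcal{X}$ in $F_1(\mathcal{X})$, i.e. the smallest subcategory of $F_1(\mathcal{X})$ that contains $\mathcal{X}$ and is closed under admissible subobjects in $F_1(\mathcal{X})$; (b) the smallest $\mathrm{Ker}_{\mathcal{X}}$-closed subcategory of $\mathcal{A}$ containing $\mathcal{X}$; (c) the smallest kernel-closed subcategory of $\mathcal{A}$ containing $\mathcal{X}$. In particular, the following are equivalent: (a) $\mathcal{X}$ is an admissible-subobject-closed subcategory of $F_1(\mathcal{X})$; (b) $\mathcal{X}$ is a $\mathrm{Ker}_{\mathcal{X}}$-closed subcategory of $\mathcal{A}$; (c) $\mathcal{X}$ is a kernel-closed subcategory of $\mathcal{A}$.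
   Context: All subcategories are full and closed under isomorphisms. A subcategory is additive if it is closed under finite direct sums and contains the zero object. A torsion-free class of $\mathcal{A}$ is a subcategory closed under subobjects and extensions. $F_1(\mathcal{X})$ denotes the smallest torsion-free class of $\mathcal{A}$ containing $\mathcal{X}$. A subcategory $\mathcal{S}$ of an extension-closed subcategory $\mathcal{F}$ of $\mathcal{A}$ is closed under admissible subobjects in $\mathcal{F}$ (admissible-subobject-closed) if for every short exact sequence $0\to A\to B\to C\to0$ in $\mathcal{A}$ with $A,B,C\in\mathcal{F}$ and $B\in\mathcal{S}$, one has $A\in\mathcal{S}$. A subcategory $\mathcal{S}$ of $\mathcal{A}$ is kernel-closed if $\mathrm{Ker} f\in\mathcal{S}$ for every morphism $f\colon S\to S'$ with $S,S'\in\mathcal{S}$. For an additive subcategory $\mathcal{Y}$ of $\mathcal{A}$, an additive subcategory $\mathcal{S}$ is $\mathrm{Ker}_{\mathcal{Y}}$-closed if $\mathrm{Ker} f\in\mathcal{S}$ for every morphism $f\colon S\to Y$ with $S\in\mathcal{S}$ and $Y\in\mathcal{Y}$. *)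

(* Defs.v *)
From HB Require Import structures.
From mathcomp Require Import all_boot all_algebra.
From mathcomp Require Import classical_sets.

Set Implicit Arguments.
Unset Strict Implicit.
Unset Printing Implicit Defensive.

Import GRing.Theory.
Local Open Scope ring_scope.
Local Open Scope classical_set_scope.

Record preadditive_category := PreadditiveCategory {
  obj :> Type;
  mor : obj -> obj -> zmodType;
  id_mor : forall a, mor a a;
  comp_mor : forall a b c, mor b c -> mor a b -> mor a c;
  comp_morA : forall a b c d (h : mor c d) (g : mor b c) (f : mor a b),
    comp_mor h (comp_mor g f) = comp_mor (comp_mor h g) f;
  comp_1mor : forall a b (f : mor a b), comp_mor (id_mor b) f = f;
  comp_mor1 : forall a b (f : mor a b), comp_mor f (id_mor a) = f;
  comp_morDl : forall a b c (g g' : mor b c) (f : mor a b),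
    comp_mor (g + g') f = comp_mor g f + comp_mor g' f;
  comp_morDr : forall a b c (g : mor b c) (f f' : mor a b),
    comp_mor g (f + f') = comp_mor g f + comp_mor g f'
}.

Arguments id_mor {A} a : rename.
Arguments comp_mor {A a b c} g f : rename.

Notation "a ~> b" := (mor a b) (at level 70, no associativity) : type_scope.
Notation "g \@ f" := (comp_mor g f)
  (at level 40, left associativity) : ring_scope.

Section CategoryNotions.
Variable A : preadditive_category.
Implicit Types a b c k q s t z : A.

Definition isomorphic a b : Prop :=
  exists (f : a ~> b) (g : b ~> a), g \@ f = id_mor a /\ f \@ g = id_mor b.

Definition mono a b (f : a ~> b) : Prop :=
  forall t (u v : t ~> a), f \@ u = f \@ v -> u = v.

Definition epi a b (f : a ~> b) : Prop :=
  forall t (u v : b ~> t), u \@ f = v \@ f -> u = v.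

(* hom-sets contain 0, so this says that z is both initial and terminal *)
Definition is_zero_object z : Prop :=
  forall a, (forall f : z ~> a, f = 0) /\ (forall f : a ~> z, f = 0).

Definition is_direct_sum a b s : Prop :=
  exists (i1 : a ~> s) (i2 : b ~> s) (p1 : s ~> a) (p2 : s ~> b),
    [/\ p1 \@ i1 = id_mor a, p2 \@ i2 = id_mor b, p1 \@ i2 = 0, p2 \@ i1 = 0
      & i1 \@ p1 + i2 \@ p2 = id_mor s].

Definition is_kernel a b (f : a ~> b) k (i : k ~> a) : Prop :=
  f \@ i = 0 /\
  forall t (u : t ~> a), f \@ u = 0 -> exists! v : t ~> k, i \@ v = u.

Definition is_cokernel a b (f : a ~> b) q (p : b ~> q) : Prop :=
  p \@ f = 0 /\
  forall t (u : b ~> t), u \@ f = 0 -> exists! v : q ~> t, v \@ p = u.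

Definition short_exact a b c (f : a ~> b) (g : b ~> c) : Prop :=
  is_kernel g f /\ is_cokernel f g.

End CategoryNotions.

Record abelian (A : preadditive_category) : Prop := Abelian {
  abelian_zero : exists z : A, is_zero_object z;
  abelian_direct_sum : forall a b : A, exists s : A, is_direct_sum a b s;
  abelian_kernel : forall (a b : A) (f : a ~> b),
    exists (k : A) (i : k ~> a), is_kernel f i;
  abelian_cokernel : forall (a b : A) (f : a ~> b),
    exists (q : A) (p : b ~> q), is_cokernel f p;
  abelian_mono : forall (a b : A) (f : a ~> b), mono f ->
    exists (c : A) (g : b ~> c), is_kernel g f;
  abelian_epi : forall (a b : A) (f : a ~> b), epi f ->
    exists (c : A) (g : c ~> a), is_cokernel g f
}.

(* A full subcategory is given by its set of objects. *)
Section Subcategories.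
Variable A : preadditive_category.
Implicit Types (S F X Y : set A).

Definition iso_closed S : Prop :=
  forall a b : A, isomorphic a b -> S a -> S b.

Definition additive_subcategory S : Prop :=
  [/\ iso_closed S,
      forall z : A, is_zero_object z -> S z
    & forall a b s : A, is_direct_sum a b s -> S a -> S b -> S s].

Definition torsion_free_class S : Prop :=
  [/\ iso_closed S,
      forall (a b : A) (f : a ~> b), mono f -> S b -> S a
    & forall (a b c : A) (f : a ~> b) (g : b ~> c),
        short_exact f g -> S a -> S c -> S b].

Definition F1 X : set A := smallest torsion_free_class X.

Definition admissible_subobject_closed F S : Prop :=
  [/\ iso_closed S,
      S `<=` F
    & forall (a b c : A) (f : a ~> b) (g : b ~> c),
        short_exact f g -> F a -> F b -> F c -> S b -> S a].

(* A kernel object is determined up to isomorphism only: all of them are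
   required to belong to S. *)
Definition kernel_closed S : Prop :=
  iso_closed S /\
  forall (a b k : A) (f : a ~> b) (i : k ~> a),
    S a -> S b -> is_kernel f i -> S k.

Definition Ker_closed Y S : Prop :=
  additive_subcategory S /\
  forall (a b k : A) (f : a ~> b) (i : k ~> a),
    S a -> Y b -> is_kernel f i -> S k.

Definition admissible_subobject_closure F X : set A :=
  smallest (admissible_subobject_closed F) X.

Definition Ker_closure Y X : set A := smallest (Ker_closed Y) X.

Definition kernel_closure X : set A := smallest kernel_closed X.

(* [smallest C X] is an intersection; the next lemmas show that it satisfies C
   itself in each case, hence is the least subcategory containing X that
   does. *)
Lemma F1_torsion_free_class X : torsion_free_class (F1 X).
Proof.
split=> [a b ab Sa T TX|a b f mf Sb T TX|a b c f g fg Sa Sc T TX].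
- by case: (TX) => -[iT _ _] _; exact: iT ab (Sa T TX).
- by case: (TX) => -[_ sT _] _; exact: sT mf (Sb T TX).
- by case: (TX) => -[_ _ eT] _; exact: eT fg (Sa T TX) (Sc T TX).
Qed.

Lemma admissible_subobject_closureP X :
  admissible_subobject_closed (F1 X) (admissible_subobject_closure (F1 X) X).
Proof.
split=> [a b ab Sa T TX||a b c f g fg Fa Fb Fc Sb T TX].
- by case: (TX) => -[iT _ _] _; exact: iT ab (Sa T TX).
- apply: smallest_sub; last exact: sub_gen_smallest.
  by split=> //; case: (F1_torsion_free_class X).
- by case: (TX) => -[_ _ aT] _; exact: aT fg Fa Fb Fc (Sb T TX).
Qed.

Lemma Ker_closureP Y X : Ker_closed Y (Ker_closure Y X).
Proof.
split=> [|a b k f i Sa Yb ki T TX].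
  split=> [a b ab Sa T TX|z z0 T TX|a b s abs Sa Sb T TX].
  - by case: (TX) => -[[iT _ _] _] _; exact: iT ab (Sa T TX).
  - by case: (TX) => -[[_ zT _] _] _; exact: zT.
  - by case: (TX) => -[[_ _ dT] _] _; exact: dT abs (Sa T TX) (Sb T TX).
by case: (TX) => -[_ kT] _; exact: kT (Sa T TX) Yb ki.
Qed.

Lemma kernel_closureP X : kernel_closed (kernel_closure X).
Proof.
split=> [a b ab Sa T TX|a b k f i Sa Sb ki T TX].
- by case: (TX) => -[iT _] _; exact: iT ab (Sa T TX).
- by case: (TX) => -[_ kT] _; exact: kT (Sa T TX) (Sb T TX) ki.
Qed.

End Subcategories.

(* Main.v *)
Require Import Defs.
From mathcomp Require Import all_boot all_algebra.
From mathcomp Require Import classical_sets.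

(** The closures satisfy (b) <= (c) <= (a) <= (b).
    (b) <= (c): the kernel of [f \o p1 : a (+) x -> a -> b] is [Ker f (+) x], so
    that the kernel closure of an additive subcategory is additive.
    (c) <= (a): [Ker f] sits in the short exact sequence
    [0 -> Ker f -> a -> Im f -> 0], whose terms belong to the torsion-free class
    [F1 X].
    (a) <= (b): let K be the Ker_X-closure. The objects c such that every
    morphism from an object of K to c has its kernel in K contain X and are
    closed under subobjects; they are closed under extensions since, for
    [0 -> c' -> c -> c'' -> 0] exact, the kernel of [b -> c] is that of the
    induced morphism [Ker (b -> c'') -> c']. Hence they contain F1(X). *)

Set Implicit Arguments.
Unset Strict Implicit.
Unset Printing Implicit Defensive.

Import GRing.Theory.
Local Open Scope ring_scope.
Local Open Scope classical_set_scope.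

(** * Kernels, cokernels, direct sums and short exact sequences *)

Section Morphisms.
Variable A : preadditive_category.
Implicit Types a b c k q s t x : A.

Lemma comp_mor0 a b c (g : b ~> c) : g \@ (0 : a ~> b) = 0.
Proof. by apply: (addrI (g \@ (0 : a ~> b))); rewrite -comp_morDr !addr0. Qed.

Lemma comp_0mor a b c (f : a ~> b) : (0 : b ~> c) \@ f = 0.
Proof. by apply: (addrI ((0 : b ~> c) \@ f)); rewrite -comp_morDl !addr0. Qed.

Lemma comp_morBr a b c (g : b ~> c) (f f' : a ~> b) :
  g \@ (f - f') = g \@ f - g \@ f'.
Proof. by apply: (addIr (g \@ f')); rewrite -comp_morDr !subrK. Qed.

Lemma mono_of_zero a b (f : a ~> b) :
  (forall t (u : t ~> a), f \@ u = 0 -> u = 0) -> mono f.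
Proof.
move=> f0 t u v fuv; apply/eqP; rewrite -subr_eq0; apply/eqP/f0.
by rewrite comp_morBr fuv subrr.
Qed.

Lemma kernel_mono a b k (f : a ~> b) (i : k ~> a) : is_kernel f i -> mono i.
Proof.
move=> [fi0 ki] t u v iuv.
have [w [_ uw]] : exists! w : t ~> k, i \@ w = i \@ v.
  by apply: ki; rewrite comp_morA fi0 comp_0mor.
by rewrite -(uw u iuv) -(uw v erefl).
Qed.

Lemma cokernel_epi a b q (f : a ~> b) (p : b ~> q) : is_cokernel f p -> epi p.
Proof.
move=> [pf0 cp] t u v upv.
have [w [_ uw]] : exists! w : q ~> t, w \@ p = v \@ p.
  by apply: cp; rewrite -comp_morA pf0 comp_mor0.
by rewrite -(uw u upv) -(uw v erefl).
Qed.

Lemma kernel_of_mono a b k (f : a ~> b) (i : k ~> a) :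
    mono i -> f \@ i = 0 ->
    (forall t (u : t ~> a), f \@ u = 0 -> exists v : t ~> k, i \@ v = u) ->
  is_kernel f i.
Proof.
move=> mi fi0 ki; split=> // t u /ki[v iv].
by exists v; split=> // w iw; apply: mi; rewrite iv iw.
Qed.

Lemma cokernel_of_epi a b q (f : a ~> b) (p : b ~> q) :
    epi p -> p \@ f = 0 ->
    (forall t (u : b ~> t), u \@ f = 0 -> exists v : q ~> t, v \@ p = u) ->
  is_cokernel f p.
Proof.
move=> ep pf0 cp; split=> // t u /cp[v vp].
by exists v; split=> // w wp; apply: ep; rewrite vp wp.
Qed.

Lemma kernel_comp_mono a b c k (f : a ~> b) (m : b ~> c) (i : k ~> a) :
  mono m -> is_kernel f i -> is_kernel (m \@ f) i.
Proof.
move=> mm [fi0 ki]; split=> [|t u mfu0]; first by rewrite -comp_morA fi0 comp_mor0.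
by apply: ki; apply: mm; rewrite comp_morA mfu0 comp_mor0.
Qed.

Lemma isomorphic_sym a b : isomorphic a b -> isomorphic b a.
Proof. by move=> [f [g [gf fg]]]; exists g, f. Qed.

Lemma isomorphic_mono a b : isomorphic a b -> exists f : a ~> b, mono f.
Proof.
move=> [f [g [gf _]]]; exists f => t u v fuv.
by rewrite -[u]comp_1mor -[v]comp_1mor -gf -!comp_morA fuv.
Qed.

Lemma direct_sum_sym a b s : is_direct_sum a b s -> is_direct_sum b a s.
Proof.
move=> [i1 [i2 [p1 [p2 [e11 e22 e12 e21 e]]]]].
by exists i2, i1, p2, p1; split=> //; rewrite addrC.
Qed.

Lemma direct_sum_iso a b x s :
  isomorphic a b -> is_direct_sum b x s -> is_direct_sum a x s.
Proof.
move=> [f [g [gf fg]]] [i1 [i2 [p1 [p2 [e11 e22 e12 e21 e]]]]].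
exists (i1 \@ f), i2, (g \@ p1), p2; split=> //.
- by rewrite -comp_morA (comp_morA p1) e11 comp_1mor.
- by rewrite -comp_morA e12 comp_mor0.
- by rewrite comp_morA e21 comp_0mor.
- by rewrite -comp_morA (comp_morA f) fg comp_1mor.
Qed.

Lemma direct_sum_short_exact a b s : is_direct_sum a b s ->
  exists (f : a ~> s) (g : s ~> b), short_exact f g.
Proof.
move=> [i1 [i2 [p1 [p2 [e11 e22 e12 e21 e]]]]]; exists i1, p2; split.
- apply: kernel_of_mono => // [t u v i1uv|t u p2u0].
    by rewrite -[u]comp_1mor -[v]comp_1mor -e11 -!comp_morA i1uv.
  exists (p1 \@ u); rewrite -[RHS]comp_1mor -e comp_morDl -!comp_morA p2u0.
  by rewrite comp_mor0 addr0.
- apply: cokernel_of_epi => // [t u v up2v|t u ui10].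
    by rewrite -[u]comp_mor1 -[v]comp_mor1 -e22 !comp_morA up2v.
  exists (u \@ i2); rewrite -[RHS]comp_mor1 -e comp_morDr !comp_morA ui10.
  by rewrite comp_0mor add0r.
Qed.

Lemma direct_sum_kernel a b k x s sa (f : a ~> b) (i : k ~> a) :
    is_kernel f i -> is_direct_sum k x s -> is_direct_sum a x sa ->
  exists (g : sa ~> b) (j : s ~> sa), is_kernel g j.
Proof.
move=> ki [i1 [i2 [p1 [p2 [e11 e22 e12 e21 e]]]]].
move=> [j1 [j2 [q1 [q2 [d11 d22 d12 d21 d]]]]].
have [fi0 fk] := ki; have mi := kernel_mono ki.
(* [j] is the direct sum of [i] and the identity of [x]; it will be the kernel of [f \@ q1]. *)
pose j : s ~> sa := j1 \@ (i \@ p1) + j2 \@ p2.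
have q1j : q1 \@ j = i \@ p1.
  by rewrite comp_morDr !comp_morA d11 d12 comp_0mor addr0 comp_1mor.
have q2j : q2 \@ j = p2.
  by rewrite comp_morDr !comp_morA d21 d22 !comp_0mor add0r comp_1mor.
exists (f \@ q1), j; apply: kernel_of_mono.
- apply: mono_of_zero => t u ju0.
  have p1u0 : p1 \@ u = 0.
    by apply: mi; rewrite comp_morA -q1j -comp_morA ju0 !comp_mor0.
  have p2u0 : p2 \@ u = 0 by rewrite -q2j -comp_morA ju0 comp_mor0.
  by rewrite -[u]comp_1mor -e comp_morDl -!comp_morA p1u0 p2u0 !comp_mor0 addr0.
- by rewrite -comp_morA q1j comp_morA fi0 comp_0mor.
- move=> t u; rewrite -comp_morA => /fk[v [iv _]].
  exists (i1 \@ v + i2 \@ (q2 \@ u)).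
  rewrite comp_morDl -!comp_morA !comp_morDr.
  rewrite ![p1 \@ (_ \@ _)]comp_morA ![p2 \@ (_ \@ _)]comp_morA e11 e12 e21 e22.
  rewrite !comp_0mor !comp_1mor !comp_mor0 addr0 add0r iv.
  by rewrite -[RHS]comp_1mor -d comp_morDl -!comp_morA.
Qed.

(* The witness q is the coimage [Coker (Ker f)]: it embeds into b. *)
Lemma kernel_short_exact (hA : abelian A) a b k (f : a ~> b) (i : k ~> a) :
    is_kernel f i ->
  exists q (p : a ~> q) (m : q ~> b), short_exact i p /\ mono m.
Proof.
move=> ki; have [fi0 fk] := ki; have mi := kernel_mono ki.
have [q [p cp]] := abelian_cokernel hA i.
have [pi0 pc] := cp; have ep := cokernel_epi cp.
have [m [mp _]] := pc _ f fi0.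
exists q, p, m; split.
  split=> //; apply: kernel_of_mono => // t u pu0.
  have [v [iv _]] : exists! v : t ~> k, i \@ v = u.
    by apply: fk; rewrite -mp -comp_morA pu0 comp_mor0.
  by exists v.
(* If [m] kills [u], it factors through the cokernel [w] of [u]. The epi [w \@ p] is the cokernel of
   some [z]; [f] kills [z], so [z] factors through [i] and [p] kills it. Hence [p] factors through
   [w \@ p], so [w] has a left inverse and [u] is 0. *)
apply: mono_of_zero => t u mu0.
have [r [w cw]] := abelian_cokernel hA u.
have [wu0 wc] := cw; have ew := cokernel_epi cw.
have [m' [m'w _]] := wc _ m mu0.
have ewp : epi (w \@ p).
  by move=> d g h; rewrite !comp_morA => /ep/ew.
have [d [z [wpz0 zc]]] := abelian_epi hA ewp.
have [z' [iz' _]] : exists! v : d ~> k, i \@ v = z.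
  by apply: fk; rewrite -mp -m'w -!comp_morA [w \@ _]comp_morA wpz0 comp_mor0.
have [v [vwp _]] : exists! v : r ~> q, v \@ (w \@ p) = p.
  by apply: zc; rewrite -iz' comp_morA pi0 comp_0mor.
have vw1 : v \@ w = id_mor q by apply: ep; rewrite -comp_morA vwp comp_1mor.
by rewrite -[u]comp_1mor -vw1 -comp_morA wu0 comp_mor0.
Qed.

(** [h] is [f \@ j] lifted through [m], and [l] is the inclusion of Ker f into Ker (g f). Since [m]
    is mono, [h] and [f \@ j] kill the same morphisms. *)
Lemma kernel_extension b c c' c'' k k'' (f : b ~> c) (i : k ~> b)
    (m : c' ~> c) (g : c ~> c'') (j : k'' ~> b) :
    is_kernel g m -> is_kernel f i -> is_kernel (g \@ f) j ->
  exists (h : k'' ~> c') (l : k ~> k''), is_kernel h l.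
Proof.
move=> gm fi gfj.
have [_ gk] := gm; have [fi0 fk] := fi; have [gfj0 gfk] := gfj.
have mm := kernel_mono gm; have mi := kernel_mono fi; have mj := kernel_mono gfj.
have [h [mh _]] : exists! h : k'' ~> c', m \@ h = f \@ j.
  by apply: gk; rewrite comp_morA.
have [l [jl _]] : exists! l : k ~> k'', j \@ l = i.
  by apply: gfk; rewrite -comp_morA fi0 comp_mor0.
exists h, l; apply: kernel_of_mono.
- by move=> t u v luv; apply: mi; rewrite -jl -!comp_morA luv.
- by apply: mm; rewrite comp_morA mh -comp_morA jl fi0 comp_mor0.
- move=> t u hu0.
  have [v [iv _]] : exists! v : t ~> k, i \@ v = j \@ u.
    by apply: fk; rewrite comp_morA -mh -comp_morA hu0 comp_mor0.
  by exists v; apply: mj; rewrite comp_morA jl.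
Qed.

End Morphisms.

(** * The inclusions between the three closures *)

Section Closures.
Variables (A : preadditive_category) (hA : abelian A).
Variables (X : set A) (hX : additive_subcategory X).

Lemma sub_F1 : X `<=` F1 X.
Proof. exact: sub_gen_smallest. Qed.

Lemma sub_kernel_closure : X `<=` kernel_closure X.
Proof. exact: sub_gen_smallest. Qed.

Lemma sub_Ker_closure : X `<=` Ker_closure X X.
Proof. exact: sub_gen_smallest. Qed.

(** A kernel is a subobject and a direct sum is an extension. This places the Ker_X-closure inside
    [F1 X], as admissible closedness demands. *)
Lemma F1_Ker_closed : Ker_closed X (F1 X).
Proof.
have [iF sF eF] := F1_torsion_free_class X.
split; last by move=> a b k f i Fa _ /kernel_mono mi; exact: sF mi Fa.
split=> // [z z0|a b s abs Fa Fb]; first by apply: sub_F1; case: hX => _ + _; apply.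
by have [f [g fg]] := direct_sum_short_exact abs; exact: eF fg Fa Fb.
Qed.

Lemma kernel_closure_direct_sum (a b s : A) :
  is_direct_sum a b s -> kernel_closure X a -> kernel_closure X b ->
  kernel_closure X s.
Proof.
have [iM kM] := kernel_closureP X.
(* Induct on one summand, first with the other in X, then in the closure. *)
have sumM (x : A) :
    (forall y t, X y -> is_direct_sum y x t -> kernel_closure X t) ->
    forall y t, kernel_closure X y -> is_direct_sum y x t -> kernel_closure X t.
  move=> Xx; pose T : set A := [set y | kernel_closure X y /\
    forall t, is_direct_sum y x t -> kernel_closure X t].
  suff MT : kernel_closure X `<=` T by move=> y t /MT[_]; apply.
  apply: smallest_sub => [|y Xy]; last first.
    by split=> [|t]; [exact: sub_kernel_closure|exact: Xx].
  split=> [y z yz [My Ty]|y z k f i [My Ty] [Mz _] ki].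
    split=> [|t zxt]; first exact: iM yz My.
    exact: Ty (direct_sum_iso yz zxt).
  split=> [|t kxt]; first exact: kM My Mz ki.
  (* [t] is the kernel of a morphism to [z] from the direct sum [u] of [y] and [x], which lies in
     the closure by [Ty]. *)
  have [u yxu] := abelian_direct_sum hA y x.
  have [g [j kj]] := direct_sum_kernel ki kxt yxu.
  exact: kM (Ty u yxu) Mz kj.
(* This replaces [a] by [y] in [X]; after the swap, [sumM y] replaces [b] by [z] in [X], where
   additivity of [X] concludes. *)
move=> abs Ma Mb; apply: (sumM b _ a) => // y t Xy /direct_sum_sym.
apply: (sumM y) => // z u Xz zyu; apply: sub_kernel_closure.
by have [_ _ dX] := hX; exact: dX zyu Xz Xy.
Qed.

Lemma Ker_closure_sub_kernel_closure : Ker_closure X X `<=` kernel_closure X.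
Proof.
have [iM kM] := kernel_closureP X.
apply: smallest_sub; last exact: sub_kernel_closure.
split=> [|a b k f i Ma /sub_kernel_closure Mb]; last exact: kM.
split=> // [z z0|]; last exact: kernel_closure_direct_sum.
by apply: sub_kernel_closure; case: hX => _ + _; apply.
Qed.

Lemma kernel_closure_sub_admissible :
  kernel_closure X `<=` admissible_subobject_closure (F1 X) X.
Proof.
have [_ sF _] := F1_torsion_free_class X.
have [iS SF aS] := admissible_subobject_closureP X.
apply: smallest_sub; last exact: sub_gen_smallest.
split=> // a b k f i Sa Sb ki.
have [q [p [m [ip mm]]]] := kernel_short_exact hA ki.
(* The end terms [k] and [q] are torsion-free as subobjects of [a] and [b]. *)
apply: (aS _ _ _ _ _ ip _ (SF _ Sa) _ Sa); last exact: sF mm (SF _ Sb).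
exact: sF (kernel_mono ki) (SF _ Sa).
Qed.

Lemma Ker_closure_kernel_F1 (a b k : A) (f : a ~> b) (i : k ~> a) :
  Ker_closure X X a -> F1 X b -> is_kernel f i -> Ker_closure X X k.
Proof.
have [_ kK] := Ker_closureP X X.
pose T : set A := [set c | forall (a k : A) (f : a ~> c) (i : k ~> a),
  Ker_closure X X a -> is_kernel f i -> Ker_closure X X k].
suff FT : F1 X `<=` T by move=> Ka /FT Tb; exact: Tb Ka.
apply: smallest_sub => [|c Xc a' k' f' i' Ka']; last exact: kK Ka' Xc.
(* Composing with a mono does not change the kernel; this also gives closure under isomorphisms. *)
have sT (c d : A) (m : c ~> d) : mono m -> T d -> T c.
  by move=> mm Td a' k' f' i' Ka' /(kernel_comp_mono mm); exact: Td.
split=> // [c d /isomorphic_sym/isomorphic_mono[m mm]|]; first exact: sT mm.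
move=> c' c c'' m g [gm _] Tc' Tc'' a' k' f' i' Ka' ki'.
have [k'' [j kj]] := abelian_kernel hA (g \@ f').
have [h [l hl]] := kernel_extension gm ki' kj.
exact: Tc' (Tc'' _ _ _ _ Ka' kj) hl.
Qed.

(** An admissible subobject of [b] is the kernel of a morphism from [b] to an object of [F1 X]. *)
Lemma admissible_sub_Ker_closure :
  admissible_subobject_closure (F1 X) X `<=` Ker_closure X X.
Proof.
have [[iK _ _] _] := Ker_closureP X X.
apply: smallest_sub; last exact: sub_Ker_closure.
split=> // [|a b c f g [gf _] _ _ Fc Kb].
  by apply: smallest_sub; [exact: F1_Ker_closed|exact: sub_F1].
exact: Ker_closure_kernel_F1 Kb Fc gf.
Qed.

End Closures.

(** This turns each closedness condition on [X] into an equation between [X] and its closure. *)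
Lemma smallest_eq_iff (T : Type) (C : set T -> Prop) (G : set T) :
  C (smallest C G) -> C G <-> smallest C G = G.
Proof. by move=> CS; split=> [/smallest_id|<-]. Qed.

Theorem theorem1p5 (A : preadditive_category) (hA : abelian A)
    (X : set A) (hX : additive_subcategory X) :
  (admissible_subobject_closure (F1 X) X = Ker_closure X X /\
   Ker_closure X X = kernel_closure X) /\
  ((admissible_subobject_closed (F1 X) X <-> Ker_closed X X) /\
   (Ker_closed X X <-> kernel_closed X)).
Proof.
have ba := admissible_sub_Ker_closure hA hX.
have cb := Ker_closure_sub_kernel_closure hA hX.
have ac := kernel_closure_sub_admissible hA (X := X).
have Eab : admissible_subobject_closure (F1 X) X = Ker_closure X X.
  by apply/seteqP; split=> // a /cb/ac.
have Ebc : Ker_closure X X = kernel_closure X.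
  by apply/seteqP; split=> // a /ac/ba.
split=> //.
have aP := smallest_eq_iff (admissible_subobject_closureP X).
have bP := smallest_eq_iff (Ker_closureP X X).
have cP := smallest_eq_iff (kernel_closureP X).
(* With equal closures, all three conditions become [Ker_closure X X = X]. *)
rewrite -/(admissible_subobject_closure _ _) Eab in aP.
rewrite -/(kernel_closure _) -Ebc in cP.
split; first exact: iff_trans aP (iff_sym bP).
exact: iff_trans bP (iff_sym cP).
Qed.
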